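(* Let $V$ be a $\mathbb{Z}^n$-graded vector space. The coproduct $\Delta:T(V)\to T(V)\bigotimes T(V)$ defined by $$\Delta(v_1\otimes\ldots\otimes v_p)=\sum_{\substack{I\cup J=N^{(p-1)}\\ I\neq\emptyset}}\varepsilon_V(I;J)\;V_I\bigotimes V_J\otimes v_p\qquad(v_\ell\in V^{v_\ell},\ p\ge1)$$ provides a graded dual Leibniz coalgebra structure on $T(V)$, i.e. a graded coalgebra structure that verifies $$(\mathrm{id}\bigotimes\Delta)\Delta=(\Delta\bigotimes\mathrm{id})\Delta+(T\bigotimes\mathrm{id})(\Delta\bigotimes\mathrm{id})\Delta,$$ where $T:T(V)\bigotimes T(V)\to T(V)\bigotimes T(V)$ is the twisting map, which exchanges two elements of the $\mathbb{Z}^n$-graded space $T(V)$ up to the corresponding Koszul sign.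
   Context: Vector spaces are over a field $\mathbb{K}$ of characteristic $0$; for $\alpha,\beta\in\mathbb{Z}^n$, $\langle\alpha,\beta\rangle=\sum_i\alpha_i\beta_i$. The notation $v\in V^v$ means that $v$ is homogeneous with degree denoted by the same symbol. $T(V)=\bigoplus_{p\ge1}V^{\otimes p}$ is the reduced tensor space, $\mathbb{Z}^n$-graded by total degree. The symbol $\bigotimes$ denotes the tensor product of two copies of $T(V)$, and $\otimes$ the tensor product inside $T(V)$. A graded coalgebra $(C,\Delta)$ is a graded vector space $C$ with a linear map $\Delta:C\to C\otimes C$ with $\Delta(C^\alpha)\subset\bigoplus_{\beta+\gamma=\alpha}C^\beta\otimes C^\gamma$ (no coassociativity or counit required). The tensor product of graded maps is $(f\otimes g)(v_1\otimes v_2)=(-1)^{\langle g,v_1\rangle}f(v_1)\otimes g(v_2)$, and the twisting map is $T(a\bigotimes b)=(-1)^{\langle a,b\rangle}b\bigotimes a$ for homogeneous $a,b$. $N^{(p)}=(1,\ldots,p)$. An unshuffle $I=(i_1<\ldots<i_{|I|})$ is a naturally ordered subset of $N^{(p)}$ (possibly empty where allowed). In sums over $I\cup J=N^{(p-1)}$, $I$ and $J$ are disjoint unshuffles with union $N^{(p-1)}$. $V_I=v_{i_1}\otimes\ldots\otimes v_{i_{|I|}}$, and $\varepsilon_V(I;J)$ is the Koszul sign of the rearrangement $(v_{i_1},\ldots,v_{i_{|I|}},v_{j_1},\ldots,v_{j_{|J|}})\to V_{I\cup J}$ (exchanging adjacent $v,w$ gives $(-1)^{\langle v,w\rangle}$).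 In particular $\Delta(v_1)=0$. *)

(* Defs.v *)
From HB Require Import structures.
From mathcomp Require Import all_boot all_algebra.
From mathcomp Require Import boolp.

Set Implicit Arguments.
Unset Strict Implicit.
Unset Printing Implicit Defensive.

Import GRing.Theory.
Local Open Scope ring_scope.

Definition lin_of (K : fieldType) (U W : lmodType K) (f : U -> W)
    (h : linear f) : {linear U -> W} :=
  HB.pack f (GRing.isLinear.Build K U W *:%R f h).

Lemma linE (K : fieldType) (U W : lmodType K) (f : {linear U -> W}) : linear f.
Proof. by move=> a x y; rewrite linearP. Qed.

(* Direct sum of a family of modules: dependent functions with finite support. *)
Section DirectSum.
Variables (K : fieldType) (I : eqType) (U : I -> lmodType K).

Definition finsupp (f : forall i, U i) : Prop :=
  exists s : seq I, forall i, i \notin s -> f i = 0.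

Record dsum := DSum { dfun :> forall i, U i; dfun_fin : finsupp dfun }.

Lemma dsumP (x y : dsum) : (forall i, x i = y i) -> x = y.
Proof.
case: x y => [f hf] [g hg] /= fg.
have e : f = g by apply: functional_extensionality_dep.
by move: hf; rewrite e => hf; congr DSum; exact: Prop_irrelevance.
Qed.

HB.instance Definition _ := gen_eqMixin dsum.
HB.instance Definition _ := gen_choiceMixin dsum.

Fact dzero_fin : finsupp (fun i => 0 : U i).
Proof. by exists [::]. Qed.
Definition dzero := DSum dzero_fin.

Fact dopp_fin (x : dsum) : finsupp (fun i => - x i).
Proof. by case: x => f [s hs]; exists s => i /hs /= ->; rewrite oppr0. Qed.
Definition dopp x := DSum (dopp_fin x).

Fact dadd_fin (x y : dsum) : finsupp (fun i => x i + y i).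
Proof.
case: x y => f [s hs] [g [t ht]]; exists (s ++ t) => i /=.
by rewrite mem_cat negb_or => /andP[/hs -> /ht ->]; rewrite addr0.
Qed.
Definition dadd x y := DSum (dadd_fin x y).

Fact dscale_fin a (x : dsum) : finsupp (fun i => a *: x i).
Proof. by case: x => f [s hs]; exists s => i /hs /= ->; rewrite scaler0. Qed.
Definition dscale a x := DSum (dscale_fin a x).

Fact daddA : associative dadd.
Proof. by move=> x y z; apply: dsumP => i /=; rewrite addrA. Qed.
Fact daddC : commutative dadd.
Proof. by move=> x y; apply: dsumP => i /=; rewrite addrC. Qed.
Fact dadd0 : left_id dzero dadd.
Proof. by move=> x; apply: dsumP => i /=; rewrite add0r. Qed.
Fact daddN : left_inverse dzero dopp dadd.
Proof. by move=> x; apply: dsumP => i /=; rewrite addNr. Qed.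
HB.instance Definition _ := GRing.isZmodule.Build dsum daddA daddC dadd0 daddN.

Fact dscaleA a b x : dscale a (dscale b x) = dscale (a * b) x.
Proof. by apply: dsumP => i /=; rewrite scalerA. Qed.
Fact dscale1 : left_id 1 dscale.
Proof. by move=> x; apply: dsumP => i /=; rewrite scale1r. Qed.
Fact dscaleDr : right_distributive dscale +%R.
Proof. by move=> a x y; apply: dsumP => i /=; rewrite scalerDr. Qed.
Fact dscaleDl x : {morph dscale^~ x : a b / a + b}.
Proof. by move=> a b; apply: dsumP => i /=; rewrite scalerDl. Qed.
HB.instance Definition _ :=
  GRing.Zmodule_isLmodule.Build K dsum dscaleA dscale1 dscaleDr dscaleDl.

Lemma dsum_linE (i : I) a (x y : dsum) : (a *: x + y) i = a *: x i + y i.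
Proof. by []. Qed.

Definition dproj (i : I) : {linear dsum -> U i} := lin_of (dsum_linE i).

Fact dinj_fin i (x : U i) : finsupp (dfwith (fun j => 0 : U j) x).
Proof.
exists [:: i] => j; rewrite inE eq_sym => ij.
by rewrite dfwith_out.
Qed.
Fact dinj_lin i : linear (fun x : U i => DSum (dinj_fin x)).
Proof.
move=> a x y; apply: dsumP => j; rewrite dsum_linE /=.
case: (eqVneq i j) => [<-|ij]; first by rewrite !dfwith_in.
by rewrite !dfwith_out// scaler0 addr0.
Qed.
Definition dinj i : {linear U i -> dsum} := lin_of (@dinj_lin i).

Lemma dinj_in i (x : U i) : dinj i x i = x.
Proof. exact: dfwith_in. Qed.
Lemma dinj_out i j (x : U i) : i != j -> dinj i x j = 0.
Proof. exact: dfwith_out. Qed.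

Definition dsupp (x : dsum) : seq I := undup (projT1 (cid (dfun_fin x))).
Lemma dsupp_uniq x : uniq (dsupp x). Proof. exact: undup_uniq. Qed.
Lemma dsuppP x i : i \notin dsupp x -> x i = 0.
Proof.
by rewrite mem_undup; case: (cid _) => s /= hs; apply: hs.
Qed.

Lemma eq_supp_sum (W : zmodType) (s t : seq I) (F : I -> W) :
  uniq s -> uniq t -> (forall i, i \notin s -> F i = 0) ->
  (forall i, i \notin t -> F i = 0) -> \sum_(i <- s) F i = \sum_(i <- t) F i.
Proof.
have aux (u w : seq I) : uniq u -> uniq w -> {subset u <= w} ->
    (forall i, i \notin u -> F i = 0) -> \sum_(i <- w) F i = \sum_(i <- u) F i.
  move=> uu uw sub h0; rewrite (bigID (mem u)) /= [X in _ + X]big1 ?addr0//.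
  rewrite -big_filter; apply: perm_big; apply: uniq_perm => //.
    exact: filter_uniq.
  move=> i; rewrite mem_filter; apply/andP/idP => [[]//|iu]; split => //.
  exact: sub.
move=> us ut hs ht.
rewrite -(aux s (undup (s ++ t))) ?undup_uniq//; last first.
  by move=> i; rewrite mem_undup mem_cat => ->.
by apply: aux; rewrite ?undup_uniq// => i; rewrite mem_undup mem_cat orbC => ->.
Qed.

Lemma dsum_dec (x : dsum) (s : seq I) : uniq s ->
  (forall i, i \notin s -> x i = 0) -> x = \sum_(i <- s) dinj i (x i).
Proof.
move=> us hs; apply: dsumP => j.
rewrite -[RHS]/(dproj j _) linear_sum /=.
case: (boolP (j \in s)) => js.
  rewrite (bigD1_seq j)//= dfwith_in big1 ?addr0// => i ij.
  by rewrite dfwith_out.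
rewrite (hs _ js) big_seq big1// => i is_.
by rewrite dfwith_out//; apply: contraNneq js => <-.
Qed.

Section Lift.
Variables (W : lmodType K) (F : forall i, {linear U i -> W}).
Definition dlift_fun (x : dsum) : W := \sum_(i <- dsupp x) F i (x i).
Lemma dlift_funE (x : dsum) s : uniq s -> (forall i, i \notin s -> x i = 0) ->
  dlift_fun x = \sum_(i <- s) F i (x i).
Proof.
move=> us hs; apply: eq_supp_sum => //; first exact: dsupp_uniq.
  by move=> i /dsuppP ->; rewrite linear0.
by move=> i /hs ->; rewrite linear0.
Qed.
Lemma dlift_lin : linear dlift_fun.
Proof.
move=> a x y; pose s := undup (dsupp x ++ dsupp y).
have us : uniq s by exact: undup_uniq.
have h i : i \notin s -> x i = 0 /\ y i = 0.
  by rewrite mem_undup mem_cat negb_or => /andP[/dsuppP-> /dsuppP->].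
rewrite !(@dlift_funE _ s)//; try by move=> i /h[].
  by rewrite scaler_sumr -big_split; apply: eq_bigr => i _; rewrite dsum_linE linearP.
by move=> i /h[hx hy]; rewrite dsum_linE hx hy scaler0 addr0.
Qed.
Definition dlift : {linear dsum -> W} := lin_of dlift_lin.
Lemma dlift_inj i (x : U i) : dlift (dinj i x) = F i x.
Proof.
rewrite [LHS](@dlift_funE _ [:: i])//; first by rewrite big_seq1 dinj_in.
by move=> j; rewrite inE eq_sym => ij; exact: dinj_out.
Qed.
End Lift.

Lemma dsum_ext (W : lmodType K) (f g : {linear dsum -> W}) :
  (forall i x, f (dinj i x) = g (dinj i x)) -> f =1 g.
Proof.
move=> h x; rewrite (dsum_dec (dsupp_uniq x) (@dsuppP x)) !linear_sum.
by apply: eq_bigr => i _.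
Qed.

End DirectSum.
Arguments dinj {K I U} i.

Section Span.
Variables (K : fieldType) (M : lmodType K) (R : M -> Prop).

Inductive span : M -> Prop :=
| Span0 : span 0
| SpanS a x y : R x -> span y -> span (a *: x + y).

Lemma span_lin a x y : span x -> span y -> span (a *: x + y).
Proof.
move=> + sy; elim=> [|b u v Ru _ IH]; first by rewrite scaler0 add0r.
by rewrite scalerDr scalerA -addrA; apply: SpanS.
Qed.
Lemma span_in x : R x -> span x.
Proof. by move=> Rx; rewrite -[x]addr0 -[x]scale1r; apply: SpanS => //; exact: Span0. Qed.

End Span.

Section QuotientModule.
Variables (K : fieldType) (M : lmodType K) (R : M -> Prop).

Definition spanb : pred M := fun x => `[< span R x >].

Fact spanb_zmod : zmod_closed spanb.
Proof.
split; first by apply/asboolP; exact: Span0.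
move=> x y /asboolP sx /asboolP sy; apply/asboolP.
by rewrite addrC -scaleN1r; apply: span_lin.
Qed.

Definition spanC : zmodClosed M :=
  HB.pack_for (zmodClosed M) spanb (GRing.isZmodClosed.Build M spanb spanb_zmod).
Definition qmod := Quotient.quot spanC.
HB.instance Definition _ := GRing.Zmodule.on qmod.

Local Open Scope quotient_scope.
Definition qpi_fun (x : M) : qmod := \pi_(Quotient.quot spanC) x.

Lemma qpi_eq x y : qpi_fun x = qpi_fun y <-> span R (x - y).
Proof.
split=> [/eqquotP|h]; first by rewrite Quotient.equivE => /asboolP.
by apply/eqquotP; rewrite Quotient.equivE; apply/asboolP.
Qed.
Lemma qrepr (x : qmod) : qpi_fun (repr x) = x.
Proof. exact: reprK. Qed.
Lemma qpi_sub x y : qpi_fun (x - y) = qpi_fun x - qpi_fun y.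
Proof. exact: raddfB. Qed.
Lemma qpi_add x y : qpi_fun (x + y) = qpi_fun x + qpi_fun y.
Proof. exact: raddfD. Qed.

Definition qscale a (x : qmod) : qmod := qpi_fun (a *: repr x).
Lemma qscale_pi a x : qscale a (qpi_fun x) = qpi_fun (a *: x).
Proof.
apply/qpi_eq; rewrite -scalerBr -[_ *: _]addr0; apply: span_lin; last exact: Span0.
by apply/qpi_eq; rewrite qrepr.
Qed.

Fact qscaleA a b x : qscale a (qscale b x) = qscale (a * b) x.
Proof. by rewrite -(qrepr x) !qscale_pi scalerA. Qed.
Fact qscale1 : left_id 1 qscale.
Proof. by move=> x; rewrite -(qrepr x) !qscale_pi scale1r. Qed.
Fact qscaleDr : right_distributive qscale +%R.
Proof.
by move=> a x y; rewrite -(qrepr x) -(qrepr y) -qpi_add !qscale_pi -qpi_add scalerDr.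
Qed.
Fact qscaleDl x : {morph qscale^~ x : a b / a + b}.
Proof. by move=> a b; rewrite -(qrepr x) !qscale_pi -qpi_add scalerDl. Qed.
HB.instance Definition _ :=
  GRing.Zmodule_isLmodule.Build K qmod qscaleA qscale1 qscaleDr qscaleDl.

Fact qpi_lin : linear qpi_fun.
Proof. by move=> a x y; rewrite qpi_add -qscale_pi. Qed.
Definition qpi : {linear M -> qmod} := lin_of qpi_lin.

Lemma qpi0 x : R x -> qpi x = 0.
Proof.
by move=> Rx; rewrite -(linear0 qpi); apply/qpi_eq; rewrite subr0; exact: span_in.
Qed.

Section Lift.
Variables (W : lmodType K) (f : {linear M -> W}).
Hypothesis f0 : forall x, R x -> f x = 0.
Definition qlift_fun (x : qmod) : W := f (repr x).
Lemma qlift_funE x : qlift_fun (qpi x) = f x.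
Proof.
apply/eqP; rewrite -subr_eq0 -linearB; apply/eqP.
have : span R (repr (qpi x) - x) by apply/qpi_eq; rewrite qrepr.
by elim=> [|a u v /f0 fu _ fv]; rewrite ?linear0// linearP fu fv scaler0 addr0.
Qed.
Fact qlift_lin : linear qlift_fun.
Proof.
move=> a x y; rewrite -(qrepr x) -(qrepr y) -qpi_lin.
by rewrite !(qlift_funE : forall u, qlift_fun (qpi_fun u) = f u) linearP.
Qed.
Definition qlift : {linear qmod -> W} := lin_of qlift_lin.
Lemma qlift_pi x : qlift (qpi x) = f x. Proof. exact: qlift_funE. Qed.
End Lift.

End QuotientModule.

Definition bilin (K : fieldType) (A B W : lmodType K) (f : A -> B -> W) : Prop :=
  (forall b, linear (f^~ b)) /\ (forall a, linear (f a)).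

(* A tensor B is the free module on A * B modulo bilinearity; tlift and tens_ext
   are its universal property. *)
Section TensorProduct.
Variables (K : fieldType) (A B : lmodType K).

Definition free_mod : lmodType K := dsum (fun _ : A * B => K^o).
Definition free_gen (a : A) (b : B) : free_mod :=
  dinj (U := fun _ : A * B => K^o) (a, b) 1.

Inductive tensor_rel : free_mod -> Prop :=
| tensor_rel_l c a a' b :
    tensor_rel (free_gen (c *: a + a') b - (c *: free_gen a b + free_gen a' b))
| tensor_rel_r c a b b' :
    tensor_rel (free_gen a (c *: b + b') - (c *: free_gen a b + free_gen a b')).

Definition tensor : lmodType K := qmod tensor_rel.
Definition tens (a : A) (b : B) : tensor := qpi tensor_rel (free_gen a b).

Lemma tens_bilin : bilin tens.
Proof.
split=> [b c a a'|a c b b']; rewrite /tens -[in RHS]linearP.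
- by apply/eqP; rewrite -subr_eq0 -linearB; apply/eqP/qpi0; exact: tensor_rel_l.
- by apply/eqP; rewrite -subr_eq0 -linearB; apply/eqP/qpi0; exact: tensor_rel_r.
Qed.

Lemma tens_ind (P : tensor -> Prop) :
  P 0 -> (forall a b x, P x -> P (tens a b + x)) -> forall x, P x.
Proof.
move=> P0 PS x; have -> : x = qpi tensor_rel (repr x) by rewrite /= qrepr.
set y := repr x; rewrite (dsum_dec (dsupp_uniq y) (@dsuppP _ _ _ y)) linear_sum.
elim/big_rec: _ => // -[a b] z _ Pz.
have -> : dinj (a, b) (y (a, b)) = y (a, b) *: free_gen a b.
  rewrite -[RHS]linearZ; congr (dinj _ _).
  by rewrite -[RHS]/(y (a, b) * 1) mulr1.
rewrite linearZ /= -[qpi_fun _ _]/(tens a b).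
have -> : y (a, b) *: tens a b = tens (y (a, b) *: a) b.
  by rewrite -[RHS]/(lin_of (tens_bilin.1 b) _) linearZ.
exact: PS.
Qed.

Section Lift.
Variables (W : lmodType K) (f : A -> B -> W) (bf : bilin f).
Fact tlift_free_lin (x : A * B) : linear (fun c : K^o => c *: f x.1 x.2).
Proof. by move=> a c c'; rewrite scalerDl scalerA. Qed.
Definition tlift_free : {linear free_mod -> W} :=
  dlift (fun x => lin_of (tlift_free_lin x)).
Lemma tlift_free_gen a b : tlift_free (free_gen a b) = f a b.
Proof. by rewrite [LHS]dlift_inj /= scale1r. Qed.
Fact tlift_rel x : tensor_rel x -> tlift_free x = 0.
Proof.
by case=> *; rewrite linearB linearP !tlift_free_gen ?bf.1 ?bf.2 subrr.
Qed.
Definition tlift : {linear tensor -> W} := qlift tlift_rel.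
Lemma tlift_tens a b : tlift (tens a b) = f a b.
Proof. by rewrite [LHS]qlift_pi tlift_free_gen. Qed.
End Lift.

Lemma tens_ext (W : lmodType K) (f g : {linear tensor -> W}) :
  (forall a b, f (tens a b) = g (tens a b)) -> f =1 g.
Proof.
by move=> h; elim/tens_ind => [|a b x e]; rewrite ?linear0// !linearD h e.
Qed.

End TensorProduct.

Lemma linear_sumP (K : fieldType) (U W : lmodType K) (I : Type) (s : seq I)
    (F : I -> U -> W) : (forall i, linear (F i)) ->
  linear (fun x => \sum_(i <- s) F i x).
Proof.
move=> h a x y; rewrite scaler_sumr -big_split.
by apply: eq_bigr => i _; exact: h.
Qed.

Arguments linear_sumP {K U W I s F} _.

Section Assoc.
Variables (K : fieldType) (A B C : lmodType K).
Fact tassoc_bilin1 (c : C) : bilin (fun (a : A) (b : B) => tens a (tens b c)).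
Proof.
split=> [b|a]; first exact: (tens_bilin _ _).1.
by move=> k b b'; rewrite (tens_bilin _ _).1 (tens_bilin _ _).2.
Qed.
Fact tassoc_bilin2 :
  bilin (fun (x : tensor A B) (c : C) => tlift (tassoc_bilin1 c) x).
Proof.
split=> [c|x]; first exact: linE.
move=> k c c'.
suff H y : tlift (tassoc_bilin1 (k *: c + c')) y =
    k *: tlift (tassoc_bilin1 c) y + tlift (tassoc_bilin1 c') y by exact: H.
elim/tens_ind: y => [|a b y e].
  by rewrite !linear0 addr0.
rewrite !linearD !tlift_tens e !(tens_bilin _ _).2 -!addrA; congr +%R.
by rewrite addrCA.
Qed.
Definition tassoc : {linear tensor (tensor A B) C -> tensor A (tensor B C)} :=
  tlift tassoc_bilin2.
Lemma tassocE a b c : tassoc (tens (tens a b) c) = tens a (tens b c).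
Proof. by rewrite !tlift_tens. Qed.
End Assoc.

Definition Zn (n : nat) : zmodType := {ffun 'I_n -> int}.
Definition dot n (a b : Zn n) : int := \sum_i a i * b i.
Definition ksign (K : fieldType) n (a b : Zn n) : K := (-1) ^ dot a b.

(* gpart d is the homogeneous component of degree d; gpart_dec and gpart_indep
   say that the space is the direct sum of its homogeneous components. *)
Record gspace (K : fieldType) (n : nat) := GSpace {
  gcarrier :> lmodType K;
  gpart : Zn n -> gcarrier -> Prop;
  gpart0 : forall d, gpart d 0;
  gpart_lin : forall d a x y,
    gpart d x -> gpart d y -> gpart d (a *: x + y);
  gpart_dec : forall x, exists (s : seq (Zn n)) (c : Zn n -> gcarrier),
    [/\ uniq s, forall d, gpart d (c d) & x = \sum_(d <- s) c d];
  gpart_indep : forall (s : seq (Zn n)) (c : Zn n -> gcarrier),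
    uniq s -> (forall d, gpart d (c d)) -> \sum_(d <- s) c d = 0 ->
    forall d, d \in s -> c d = 0
}.

Section Homspan.
Variables (K : fieldType) (n : nat) (W : lmodType K) (P : Zn n -> W -> Prop).
Hypothesis P0 : forall d, P d 0.
Hypothesis Pl : forall d a x y, P d x -> P d y -> P d (a *: x + y).
Lemma homspan_dec x : span (fun y => exists d, P d y) x ->
  exists (s : seq (Zn n)) (c : Zn n -> W),
    [/\ uniq s, forall d, P d (c d) & x = \sum_(d <- s) c d].
Proof.
elim=> [|a u y [d Pu] _ [s [c [us Pc ->]]]].
  by exists [::], (fun=> 0); split => //; rewrite big_nil.
pose c' e := (if e == d then a else 0) *: u + (if e \in s then c e else 0).
have [t [ut dt st]] : exists t : seq (Zn n),
    [/\ uniq t, d \in t & {subset s <= t}].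
  exists (undup (d :: s)); split; rewrite ?undup_uniq ?mem_undup ?mem_head//.
  by move=> e es; rewrite mem_undup inE es orbT.
exists t, c'; split => //.
  move=> e; rewrite /c'; case: eqP => [->|_]; last rewrite scale0r add0r.
    by apply: Pl => //; case: ifP.
  by case: ifP.
rewrite big_split /=; congr +%R.
  rewrite (bigD1_seq d)//= eqxx.
  by rewrite big1 ?addr0// => e /negbTE ->; rewrite scale0r.
rewrite -big_mkcond -[RHS]big_filter; apply: perm_big; apply: uniq_perm => //.
  by rewrite filter_uniq.
move=> e; rewrite mem_filter; case: (boolP (e \in s)) => //= es.
by rewrite st.
Qed.
End Homspan.

(* gcomp d x is the component of degree d of x, and gsupp x a finite list of
   degrees outside which these components vanish. *)
Section Components.
Variables (K : fieldType) (n : nat) (V : gspace K n).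

Lemma gdec_exists (x : V) : exists c : dsum (fun _ : Zn n => V),
  (forall d, gpart d (c d)) /\
  forall s, uniq s -> (forall d, d \notin s -> c d = 0) ->
    x = \sum_(d <- s) c d.
Proof.
have [s [c [us hc e]]] := gpart_dec x.
pose f d := if d \in s then c d else 0.
have hf : finsupp (U := fun _ : Zn n => gcarrier V) f.
  by exists s => d /negbTE ds; rewrite /f ds.
exists (DSum hf); split => [d|t ut ht] /=.
  by rewrite /f; case: ifP => // _; exact: gpart0.
rewrite {}e -(eq_supp_sum us ut _ ht); last by move=> d /negbTE; rewrite /= /f => ->.
by rewrite big_seq [RHS]big_seq; apply: eq_bigr => d ds; rewrite /= /f ds.
Qed.

Definition gdec_fun (x : V) : dsum (fun _ : Zn n => V) := projT1 (cid (gdec_exists x)).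
Lemma gdec_part x d : gpart d (gdec_fun x d).
Proof. by rewrite /gdec_fun; case: cid => c []. Qed.
Lemma gdec_sum x s : uniq s -> (forall d, d \notin s -> gdec_fun x d = 0) ->
    x = \sum_(d <- s) gdec_fun x d.
Proof. by rewrite /gdec_fun; case: cid => c [_ h] /=; exact: h. Qed.

Lemma gdec_uniq x (c : dsum (fun _ : Zn n => V)) s : uniq s ->
  (forall d, d \notin s -> c d = 0) -> (forall d, gpart d (c d)) ->
  x = \sum_(d <- s) c d -> gdec_fun x = c.
Proof.
move=> us hs pc e; apply: dsumP => d.
pose t := undup (d :: dsupp (gdec_fun x) ++ s).
have ut : uniq t by exact: undup_uniq.
have h e' : e' \notin t -> gdec_fun x e' = 0 /\ c e' = 0.
  rewrite mem_undup inE mem_cat !negb_or => /and3P[_ /dsuppP-> /hs->].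
  by [].
have e1 := gdec_sum ut (fun e' he => (h e' he).1).
have e2 : x = \sum_(d <- t) c d.
  by rewrite e; apply: eq_supp_sum => // e' /h[].
apply/eqP; rewrite -subr_eq0; apply/eqP.
apply: (gpart_indep (s := t) (c := fun d => gdec_fun x d - c d)) => //.
- move=> e'; rewrite addrC -scaleN1r; apply: gpart_lin => //; exact: gdec_part.
- by rewrite sumrB -e1 -e2 subrr.
- by rewrite mem_undup mem_head.
Qed.

Fact gdec_lin : linear gdec_fun.
Proof.
move=> a x y; pose t := undup (dsupp (gdec_fun x) ++ dsupp (gdec_fun y)).
have ut : uniq t by exact: undup_uniq.
have h e' : e' \notin t -> gdec_fun x e' = 0 /\ gdec_fun y e' = 0.
  by rewrite mem_undup mem_cat !negb_or => /andP[/dsuppP-> /dsuppP->].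
apply: (gdec_uniq (s := t)) => //.
- by move=> d /h[e1 e2]; rewrite dsum_linE e1 e2 scaler0 addr0.
- by move=> d; apply: gpart_lin; exact: gdec_part.
- rewrite {1}(gdec_sum ut (fun d hd => (h d hd).1)).
  rewrite {1}(gdec_sum ut (fun d hd => (h d hd).2)).
  by rewrite scaler_sumr -big_split.
Qed.
Definition gdec : {linear V -> dsum (fun _ : Zn n => V)} := lin_of gdec_lin.

Definition gcomp (d : Zn n) : {linear V -> V} :=
  lin_of (linE (dproj (fun _ : Zn n => gcarrier V) d \o gdec)).
Definition gsupp (x : V) : seq (Zn n) := dsupp (gdec x).

Lemma gcompE d x : gcomp d x = gdec x d. Proof. by []. Qed.
Lemma gcomp_part d x : gpart d (gcomp d x). Proof. exact: gdec_part. Qed.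
Lemma gsupp_uniq x : uniq (gsupp x). Proof. exact: dsupp_uniq. Qed.
Lemma gsuppP x d : d \notin gsupp x -> gcomp d x = 0.
Proof. exact: dsuppP. Qed.
Lemma gcomp_sum x : x = \sum_(d <- gsupp x) gcomp d x.
Proof. by apply: gdec_sum; [exact: gsupp_uniq|exact: gsuppP]. Qed.

Lemma gdec_hom d x : gpart d x -> gdec x = dinj d x.
Proof.
move=> hx; apply: (gdec_uniq (s := [:: d])) => //.
- by move=> e; rewrite inE eq_sym; exact: dinj_out.
- move=> e; case: (eqVneq d e) => [<-|de]; first by rewrite dinj_in.
  by rewrite dinj_out//; exact: gpart0.
- by rewrite big_seq1 dinj_in.
Qed.
Lemma gcomp_in d x : gpart d x -> gcomp d x = x.
Proof. by move=> h; rewrite gcompE (gdec_hom h) dinj_in. Qed.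
Lemma gcomp_out d e x : gpart d x -> d != e -> gcomp e x = 0.
Proof. by move=> h de; rewrite gcompE (gdec_hom h) dinj_out. Qed.

Section Gsum.
Variables (W : lmodType K) (F : Zn n -> V -> W).
Hypothesis Flin : forall d, linear (F d).
Lemma gsum_dlift x : \sum_(d <- gsupp x) F d (gcomp d x) =
  dlift (fun d => lin_of (Flin d)) (gdec x).
Proof. by []. Qed.
Lemma gsum_lin : linear (fun x => \sum_(d <- gsupp x) F d (gcomp d x)).
Proof. by move=> a x y; rewrite !gsum_dlift !linearP. Qed.
Lemma gsum_hom d x : gpart d x ->
  \sum_(e <- gsupp x) F e (gcomp e x) = F d x.
Proof. by move=> h; rewrite gsum_dlift (gdec_hom h) dlift_inj. Qed.
End Gsum.

End Components.
Arguments gcomp {K n V} d.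
Arguments gsum_lin {K n V W F} _.
Arguments gsum_hom {K n V W F} _ {d x} _.

Section GradedTensor.
Variables (K : fieldType) (n : nat) (A B : gspace K n).

Inductive homtens (d : Zn n) : tensor A B -> Prop :=
| Homtens e f a b : e + f = d -> gpart e a -> gpart f b -> homtens d (tens a b).

(* The component of degree d is the sum of the A^e (x) B^f for e + f = d. *)
Definition tpart (d : Zn n) : tensor A B -> Prop := span (homtens d).

Fact tpart0 d : tpart d 0. Proof. exact: Span0. Qed.
Fact tpart_lin d a x y : tpart d x -> tpart d y -> tpart d (a *: x + y).
Proof. exact: span_lin. Qed.

Lemma tens_suml (I : Type) (s : seq I) (F : I -> A) (b : B) :
  tens (\sum_(i <- s) F i) b = \sum_(i <- s) tens (F i) b.
Proof. exact: (linear_sum (lin_of ((tens_bilin A B).1 b))). Qed.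
Lemma tens_sumr (I : Type) (s : seq I) (F : I -> B) (a : A) :
  tens a (\sum_(i <- s) F i) = \sum_(i <- s) tens a (F i).
Proof. exact: (linear_sum (lin_of ((tens_bilin A B).2 a))). Qed.

Fact tpart_dec x : exists (s : seq (Zn n)) (c : Zn n -> tensor A B),
    [/\ uniq s, forall d, tpart d (c d) & x = \sum_(d <- s) c d].
Proof.
apply: homspan_dec; [exact: tpart0|exact: tpart_lin|].
elim/tens_ind: x => [|a b x sx]; first exact: Span0.
rewrite (gcomp_sum a) (gcomp_sum b) tens_suml.
elim/big_rec: _ => [|d y _ sy]; first by rewrite add0r.
rewrite -addrA tens_sumr; elim/big_rec: _ => [|e z _ sz]; first by rewrite add0r.
rewrite -addrA -[tens _ _]scale1r; apply: SpanS => //.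
exists (d + e); apply: span_in; apply: (@Homtens _ d e) => //; exact: gcomp_part.
Qed.

Definition tcomp_fun (d : Zn n) (a : A) (b : B) : tensor A B :=
  \sum_(e <- gsupp a) tens (gcomp e a) (gcomp (d - e) b).
Fact tcomp_bilin d : bilin (tcomp_fun d).
Proof.
split=> [b|a].
  apply: (gsum_lin (F := fun e a => tens a (gcomp (d - e) b))) => e.
  exact: (tens_bilin _ _).1.
apply: (linear_sumP (F := fun e b => tens (gcomp e a) (gcomp (d - e) b))).
by move=> e k b b'; rewrite linearP (tens_bilin _ _).2.
Qed.
Definition tcomp d : {linear tensor A B -> tensor A B} := tlift (tcomp_bilin d).

Lemma tcomp_hom d e x : tpart d x -> tcomp e x = (if e == d then x else 0).
Proof.
elim=> [|k _ y [d1 d2 a b <- ha hb] _ IH]; first by rewrite linear0; case: ifP.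
rewrite linearP IH tlift_tens /tcomp_fun.
rewrite (gsum_hom (F := fun e' a => tens a (gcomp (e - e') b)) _ ha); last first.
  by move=> e'; exact: (tens_bilin _ _).1.
case: eqP => [->|ne]; first by rewrite addrAC subrr add0r (gcomp_in hb).
rewrite (gcomp_out hb) ?addr0; last first.
  by apply/eqP => h; apply: ne; rewrite h addrCA subrr addr0.
by rewrite (linear0 (lin_of ((tens_bilin A B).2 a)) : tens a 0 = 0) scaler0.
Qed.

Fact tpart_indep (s : seq (Zn n)) (c : Zn n -> tensor A B) :
    uniq s -> (forall d, tpart d (c d)) -> \sum_(d <- s) c d = 0 ->
    forall d, d \in s -> c d = 0.
Proof.
move=> us hc h d ds; have := congr1 (tcomp d) h.
rewrite linear0 linear_sum (bigD1_seq d)// (tcomp_hom _ (hc d)) eqxx.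
rewrite big1 => [|e ed]; first by move=> <-; rewrite [RHS]addr0.
by rewrite (tcomp_hom _ (hc e)) eq_sym (negbTE ed).
Qed.

Definition gtensor : gspace K n :=
  GSpace tpart0 tpart_lin tpart_dec tpart_indep.

End GradedTensor.

Section GradedSum.
Variables (K : fieldType) (n : nat) (I : eqType) (U : I -> gspace K n).
Local Notation S := (dsum (fun i => gcarrier (U i))).

Definition dpart (d : Zn n) (x : S) : Prop := forall i, gpart d (x i).

Fact dpart0 d : dpart d 0. Proof. by move=> i; exact: gpart0. Qed.
Fact dpart_lin d a x y : dpart d x -> dpart d y -> dpart d (a *: x + y).
Proof. by move=> hx hy i; exact: gpart_lin. Qed.
Fact dpart_dec x : exists (s : seq (Zn n)) (c : Zn n -> S),
    [/\ uniq s, forall d, dpart d (c d) & x = \sum_(d <- s) c d].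
Proof.
apply: homspan_dec; [exact: dpart0|exact: dpart_lin|].
rewrite (dsum_dec (dsupp_uniq x) (@dsuppP _ _ _ x)).
elim/big_rec: _ => [|i y _ sy]; first exact: Span0.
rewrite (gcomp_sum (x i)) linear_sum.
elim/big_rec: _ => [|d z _ sz]; first by rewrite add0r.
rewrite -addrA -[dinj _ _]scale1r; apply: SpanS => //; exists d => j.
case: (eqVneq i j) => [<-|ij]; first by rewrite dinj_in; exact: gcomp_part.
by rewrite dinj_out//; exact: gpart0.
Qed.
Fact dpart_indep (s : seq (Zn n)) (c : Zn n -> S) :
    uniq s -> (forall d, dpart d (c d)) -> \sum_(d <- s) c d = 0 ->
    forall d, d \in s -> c d = 0.
Proof.
move=> us hc h d ds; apply: dsumP => i.
apply: (gpart_indep (g := U i) us (c := fun e => c e i) _ _ ds) => [e|].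
  exact: hc.
have := congr1 (dproj (fun i => gcarrier (U i)) i) h.
by rewrite linear_sum.
Qed.

Definition gdsum : gspace K n :=
  GSpace dpart0 dpart_lin dpart_dec dpart_indep.

End GradedSum.

Section GradedMaps.
Variables (K : fieldType) (n : nat).

(* gtmap d f g is the tensor product of f and g, where d is the degree of g:
   (f (x) g)(a (x) b) = (-1)^<d, |a|> f a (x) g b. *)
Section Tmap.
Variables (A B A' B' : gspace K n) (d : Zn n).
Variables (f : {linear A -> A'}) (g : {linear B -> B'}).
Definition gtmap_fun (a : A) (b : B) : gtensor A' B' :=
  \sum_(e <- gsupp a) ksign K d e *: tens (f (gcomp e a)) (g b).
Fact gtmap_bilin : bilin gtmap_fun.
Proof.
split=> [b|a].
  apply: (gsum_lin (F := fun e a => ksign K d e *: tens (f a) (g b))) => e k a a'.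
  by rewrite linearP (tens_bilin _ _).1 scalerDr !scalerA mulrC.
apply: (linear_sumP
  (F := fun e b => ksign K d e *: tens (f (gcomp e a)) (g b))) => e k b b'.
by rewrite linearP (tens_bilin _ _).2 scalerDr !scalerA mulrC.
Qed.
Definition gtmap : {linear gtensor A B -> gtensor A' B'} := tlift gtmap_bilin.
Lemma gtmapE e a b : gpart e a ->
  gtmap (tens a b) = ksign K d e *: tens (f a) (g b).
Proof.
move=> ha; rewrite tlift_tens /gtmap_fun.
rewrite (gsum_hom (F := fun e a => ksign K d e *: tens (f a) (g b)) _ ha)//.
move=> e' k x y.
by rewrite linearP (tens_bilin _ _).1 scalerDr !scalerA mulrC.
Qed.
End Tmap.

(* twist (a (x) b) = (-1)^<|a|, |b|> b (x) a, extended linearly. *)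
Section Twist.
Variables (A B : gspace K n).
Definition twist_fun (a : A) (b : B) : gtensor B A :=
  \sum_(d <- gsupp a) \sum_(e <- gsupp b)
    ksign K d e *: tens (gcomp e b) (gcomp d a).
Fact twist_lin1 (d : Zn n) (b : B) : linear (fun a : A =>
  \sum_(e <- gsupp b) ksign K d e *: tens (gcomp e b) a).
Proof.
apply: (linear_sumP (F := fun e a => ksign K d e *: tens (gcomp e b) a)).
by move=> e k a a'; rewrite (tens_bilin _ _).2 scalerDr !scalerA mulrC.
Qed.
Fact twist_lin2 (d : Zn n) (a : A) (e : Zn n) : linear (fun b : B =>
  ksign K d e *: tens b a).
Proof.
by move=> k b b'; rewrite (tens_bilin _ _).1 scalerDr !scalerA mulrC.
Qed.
Fact twist_bilin : bilin twist_fun.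
Proof.
split=> [b|a].
  exact: (gsum_lin (F := fun d a =>
    \sum_(e <- gsupp b) ksign K d e *: tens (gcomp e b) a) (twist_lin1^~ b)).
apply: (linear_sumP (F := fun d b =>
    \sum_(e <- gsupp b) ksign K d e *: tens (gcomp e b) (gcomp d a))) => d.
exact: (gsum_lin (F := fun e b => ksign K d e *: tens b (gcomp d a))
  (twist_lin2 d (gcomp d a))).
Qed.
Definition twist : {linear gtensor A B -> gtensor B A} := tlift twist_bilin.
Lemma twistE d e a b : gpart d a -> gpart e b ->
  twist (tens a b) = ksign K d e *: tens b a.
Proof.
move=> ha hb; rewrite tlift_tens /twist_fun.
rewrite (gsum_hom (F := fun d a =>
    \sum_(e <- gsupp b) ksign K d e *: tens (gcomp e b) a) (twist_lin1^~ b) ha).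
exact: (gsum_hom (F := fun e b => ksign K d e *: tens b a) (twist_lin2 d a) hb).
Qed.
End Twist.

Definition gassoc (A B C : gspace K n) :
  {linear gtensor (gtensor A B) C -> gtensor A (gtensor B C)} := tassoc A B C.

Definition graded_coalgebra (C : gspace K n)
    (Delta : {linear C -> gtensor C C}) : Prop :=
  forall (d : Zn n) (x : C), gpart d x -> gpart d (Delta x).

(* The identity map, the coproduct and the twist all have degree 0.  Both sides
   are compared in C (x) (C (x) C). *)
Definition dual_leibniz_identity (C : gspace K n)
    (Delta : {linear C -> gtensor C C}) : Prop :=
  forall x : C,
    gtmap 0 idfun Delta (Delta x) =
    gassoc C C C (gtmap 0 Delta idfun (Delta x)) +
    gassoc C C C (gtmap 0 (twist C C) idfun (gtmap 0 Delta idfun (Delta x))).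

Definition graded_dual_leibniz_coalgebra (C : gspace K n)
    (Delta : {linear C -> gtensor C C}) : Prop :=
  graded_coalgebra Delta /\ dual_leibniz_identity Delta.

End GradedMaps.

Section ReducedTensor.
Variables (K : fieldType) (n : nat) (V : gspace K n).

(* tpow p is the (p+1)-st tensor power of V, nested to the right. *)
Fixpoint tpow (p : nat) : gspace K n :=
  if p is p'.+1 then gtensor V (tpow p') else V.

Definition redT : gspace K n := gdsum tpow.

Fixpoint tmon (v : V) (s : seq V) : tpow (size s) :=
  if s is w :: s' return tpow (size s) then tens v (tmon w s') else v.

(* The pure tensor of a nonempty word, in the reduced tensor space; the empty
   word, which has no counterpart there, is sent to 0 by convention. *)
Definition tword (s : seq V) : redT :=
  if s is v :: s' then dinj (U := fun p => gcarrier (tpow p)) (size s') (tmon v s')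
  else 0.

End ReducedTensor.

(* Signs of rearrangements of words in the indices 0, ..., p-1, where the letter
   i stands for a vector of degree deg i: each inversion costs a sign.  By
   koszul_sorted and koszul_swap, this is the sign obtained by sorting the word
   through exchanges of adjacent letters. *)
Section Koszul.
Variables (K : fieldType) (n p : nat) (deg : 'I_p -> Zn n).

Fixpoint koszul (s : seq 'I_p) : K :=
  if s is i :: s' then
    (\prod_(j <- s' | (j < i)%N) ksign K (deg i) (deg j)) * koszul s'
  else 1.

Lemma koszul_sorted (s : seq 'I_p) :
  sorted (fun i j : 'I_p => (i < j)%N) s -> koszul s = 1.
Proof.
elim: s => //= i s IH ps; rewrite IH ?(path_sorted ps)// mulr1.
have tr : transitive (fun i j : 'I_p => (i < j)%N).
  by move=> x y z; exact: ltn_trans.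
rewrite big_seq_cond big_pred0// => j; apply/negP => /andP[js ji].
move: ps; rewrite path_sortedE// => /andP[/allP/(_ j js)/= ij _].
by move: (ltn_trans ij ji); rewrite ltnn.
Qed.

Lemma ksignC (a b : Zn n) : ksign K a b = ksign K b a.
Proof.
by rewrite /ksign /dot; congr (_ ^ _); apply: eq_bigr => i _; rewrite mulrC.
Qed.
Lemma ksign_sqr (a b : Zn n) : ksign K a b * ksign K a b = 1.
Proof. by rewrite /ksign -exprzMl ?unitrN1// mulrNN mulr1 exp1rz. Qed.

Lemma koszul_swap (s t : seq 'I_p) (i j : 'I_p) : i != j ->
  koszul (s ++ i :: j :: t) =
  ksign K (deg i) (deg j) * koszul (s ++ j :: i :: t).
Proof.
move=> ij; elim: s => [|k s IH] /=.
  rewrite !big_cons; case: (ltngtP j i) => [ji|ji|/val_inj ji].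
  - by rewrite -!mulrA; congr (_ * _); rewrite mulrCA.
  - by rewrite (ksignC (deg j)) !mulrA ksign_sqr mul1r [X in X * _]mulrC.
  - by rewrite ji eqxx in ij.
rewrite IH mulrCA; congr (_ * (_ * _)); apply: perm_big.
by rewrite perm_cat2l; apply: (permEl (perm_catCA [:: i] [:: j] t)).
Qed.

(* enum lists a set of indices in increasing order. *)
Definition unshuffle_sign (I J : {set 'I_p}) : K := koszul (enum I ++ enum J).

End Koszul.

Section Coproduct.
Variables (K : fieldType) (n : nat) (V : gspace K n).

(* The word v_1 ... v_{p+1} is indexed by 'I_p.+1, its last letter being at
   ord_max; I ranges over the nonempty subsets of the first p positions, and
   J is the complement of I among them. *)
Definition coproduct_formula
    (Delta : {linear redT V -> gtensor (redT V) (redT V)}) : Prop :=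
  forall (p : nat) (deg : 'I_p.+1 -> Zn n) (v : 'I_p.+1 -> V),
    (forall i, gpart (deg i) (v i)) ->
    let w := widen_ord (leqnSn p) in
    Delta (tword [seq v i | i <- enum 'I_p.+1]) =
    \sum_(I : {set 'I_p} | I != set0)
      unshuffle_sign K (fun i => deg (w i)) I (~: I) *:
        tens (tword [seq v (w i) | i <- enum I])
             (tword (rcons [seq v (w j) | j <- enum (~: I)] (v ord_max))).

End Coproduct.

(* Main.v *)
Require Import Defs.
From mathcomp Require Import all_boot all_algebra.

Set Implicit Arguments.
Unset Strict Implicit.
Unset Printing Implicit Defensive.

Import GRing.Theory.
Local Open Scope ring_scope.

(** The reduced tensor space is generated from its letters by the operators
[L_v : x |-> v (x) x] ([lmul]).  Let [v] be homogeneous.  In the unshuffle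
formula for [v (x) x] the new first letter [v] goes either to the left word or
to the right word, and the empty left word becomes allowed when [v] joins it.
Hence, if [v (x) x] also denotes the element of [T(V) (x) T(V)] with the letter
[v] on the left,

    [Delta (L_v x) = v (x) x + (L_v (x) id) (Delta x) + (id (x) L_v) (Delta x)],

where the Koszul sign of moving [v] past the left word is the one built into
the graded tensor product [id (x) L_v] of a map of degree [|v|].  Together with
[Delta v = 0] this recursion determines a linear map [coprod], and none of the
unshuffle combinatorics is needed to work with it.

The dual Leibniz identity is then proved by induction on the number of letters
([leibniz_step]).  Let [L^1, L^2, L^3] be [L_v] acting on the three factors of
[T(V) (x) T(V) (x) T(V)], with signs, and put [X = (id (x) Delta) (Delta x)]
and [Y = (Delta (x) id) (Delta x)]; let [tau] twist the first two factors.
Expanding with the recursion gives, for [L_v x] instead of [x],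

  - left-hand side: [v (x) Delta x + N + L^1 X + L^2 X + L^3 X],
  - first term on the right: [v (x) Delta x + L^1 Y + L^2 Y + L^3 Y],
  - its twist: [N + L^2 (tau Y) + L^1 (tau Y) + L^3 (tau Y)],

where [N] inserts [v] as a middle factor: it is what twisting makes of
[v (x) Delta x].  The twist exchanges [L^1] and [L^2] and commutes with [L^3],
so [X = Y + tau Y] implies the identity for [L_v x].

The unshuffle formula is recovered from the recursion by splitting subsets of
the positions according to whether they contain the first one ([big_cons_set],
[coprod_formula]).  It determines the coproduct because words with homogeneous
letters span ([redT_ext]). *)

(** * Koszul signs *)

Section Signs.
Variables (K : fieldType) (n : nat).
Implicit Types a b c : Zn n.

Lemma ksign0 a : ksign K 0 a = 1.
Proof. by rewrite /ksign /dot big1 ?expr0z// => i _; rewrite ffunE mul0r. Qed.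

Lemma ksignDr a b c : ksign K a (b + c) = ksign K a b * ksign K a c.
Proof.
rewrite /ksign -expfzDr ?oppr_eq0 ?oner_eq0//; congr (_ ^ _).
by rewrite /dot -big_split; apply: eq_bigr => i _; rewrite ffunE mulrDr.
Qed.

Lemma ksignDl a b c : ksign K (a + b) c = ksign K a c * ksign K b c.
Proof. by rewrite ksignC ksignDr !(ksignC _ c). Qed.

Lemma ksign_sumr (I : Type) (s : seq I) (F : I -> Zn n) a :
  ksign K a (\sum_(i <- s) F i) = \prod_(i <- s) ksign K a (F i).
Proof.
elim: s => [|i s IH]; first by rewrite !big_nil ksignC ksign0.
by rewrite !big_cons ksignDr IH.
Qed.

End Signs.

(** * Homogeneous elements and tensor products of graded maps *)

Section Graded.
Variables (K : fieldType) (n : nat).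

Lemma tens_linl (A B : lmodType K) (b : B) : linear (fun a : A => tens a b).
Proof. exact: (tens_bilin A B).1. Qed.

Lemma tensZl (A B : lmodType K) k (a : A) (b : B) : tens (k *: a) b = k *: tens a b.
Proof. exact: (linearZZ (lin_of ((tens_bilin A B).1 b))). Qed.
Lemma tensZr (A B : lmodType K) k (a : A) (b : B) : tens a (k *: b) = k *: tens a b.
Proof. exact: (linearZZ (lin_of ((tens_bilin A B).2 a))). Qed.
Lemma tensDl (A B : lmodType K) (a a' : A) (b : B) :
  tens (a + a') b = tens a b + tens a' b.
Proof. exact: (linearD (lin_of ((tens_bilin A B).1 b))). Qed.
Lemma tensDr (A B : lmodType K) (a : A) (b b' : B) :
  tens a (b + b') = tens a b + tens a b'.
Proof. exact: (linearD (lin_of ((tens_bilin A B).2 a))). Qed.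
Lemma tens0r (A B : lmodType K) (a : A) : tens a (0 : B) = 0.
Proof. exact: (linear0 (lin_of ((tens_bilin A B).2 a))). Qed.
Lemma tens0l (A B : lmodType K) (b : B) : tens (0 : A) b = 0.
Proof. exact: (linear0 (lin_of ((tens_bilin A B).1 b))). Qed.

Lemma gpartZ (A : gspace K n) d k (x : A) : gpart d x -> gpart d (k *: x).
Proof. by move=> hx; rewrite -[_ *: _]addr0; apply: gpart_lin => //; exact: gpart0. Qed.
Lemma gpartD (A : gspace K n) d (x y : A) : gpart d x -> gpart d y -> gpart d (x + y).
Proof. by move=> hx hy; rewrite -[x]scale1r; exact: gpart_lin. Qed.
Lemma gpart_sum (A : gspace K n) d (I : Type) (s : seq I) (F : I -> A) :
  (forall i, gpart d (F i)) -> gpart d (\sum_(i <- s) F i).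
Proof.
move=> h; elim/big_rec: _ => [|i y _ hy]; first exact: gpart0.
exact: gpartD.
Qed.

Lemma gpart_tens (A B : gspace K n) d e (a : A) (b : B) :
  gpart d a -> gpart e b -> @gpart K n (gtensor A B) (d + e) (tens a b).
Proof. by move=> ha hb; apply: span_in; exact: Homtens. Qed.

(** Every tensor is a sum of homogeneous pure tensors, on which the signs in
[gtmap] and [twist] are explicit.  An induction principle is used rather than
an extensionality lemma for linear maps: no composite has then to be packaged
as a linear map. *)
Lemma gtens_ind (A B : gspace K n) (P : gtensor A B -> Prop) :
    P 0 -> (forall x y, P x -> P y -> P (x + y)) ->
    (forall d e (a : A) (b : B), gpart d a -> gpart e b -> P (tens a b)) ->
  forall x, P x.
Proof.
move=> P0 PD Pt; elim/tens_ind => [//|a b x Px]; apply: (PD) => //.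
rewrite (gcomp_sum a) tens_suml; apply: (big_ind P P0 PD) => d _.
rewrite (gcomp_sum b) tens_sumr; apply: (big_ind P P0 PD) => e _.
exact: Pt (gcomp_part _ _) (gcomp_part _ _).
Qed.

Lemma gtens3_ind (A B C : gspace K n) (P : gtensor (gtensor A B) C -> Prop) :
    P 0 -> (forall x y, P x -> P y -> P (x + y)) ->
    (forall d e f (a : A) (b : B) (c : C), gpart d a -> gpart e b -> gpart f c ->
      P (tens (tens a b) c)) ->
  forall x, P x.
Proof.
move=> P0 PD Pt; elim/gtens_ind => // _ f x c _ hc.
elim/gtens_ind: x => [|x y Px Py|d e a b ha hb]; first by rewrite tens0l.
  by rewrite tensDl; exact: PD.
exact: Pt ha hb hc.
Qed.

Definition hom_map (A B : gspace K n) (e : Zn n) (f : A -> B) : Prop :=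
  forall d x, gpart d x -> gpart (d + e) (f x).

Lemma hom_map0 (A B : gspace K n) (f : A -> B) d x :
  hom_map 0 f -> gpart d x -> gpart d (f x).
Proof. by move=> hf /hf; rewrite addr0. Qed.

Section Gtmap.
Variables (A B A' B' : gspace K n).

(** A map of degree 0 on the right creates no sign, whatever the components of
[a] are. *)
Lemma gtmap0E (f : {linear A -> A'}) (g : {linear B -> B'}) (a : A) (b : B) :
  gtmap 0 f g (tens a b) = tens (f a) (g b).
Proof.
rewrite [LHS]tlift_tens [in RHS](gcomp_sum a) linear_sum tens_suml.
by apply: eq_bigr => d _; rewrite ksign0 scale1r.
Qed.

Lemma gtmap_hom d e (f : {linear A -> A'}) (g : {linear B -> B'}) :
  hom_map d f -> hom_map e g -> hom_map (d + e) (gtmap e f g).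
Proof.
move=> hf hg k x; elim=> [|c _ y [d1 d2 a b <- ha hb] _ IH].
  by rewrite linear0; exact: gpart0.
rewrite linearP; apply: gpart_lin => //.
rewrite (gtmapE _ _ _ _ ha); apply: gpartZ.
by rewrite addrACA; apply: gpart_tens; [exact: hf|exact: hg].
Qed.

Lemma gtmap_linl d k (f f1 f2 : {linear A -> A'}) (g : {linear B -> B'}) y :
  (forall x, f x = k *: f1 x + f2 x) ->
  gtmap d f g y = k *: gtmap d f1 g y + gtmap d f2 g y.
Proof.
move=> ff; elim/gtens_ind: y => [|x y hx hy|d1 d2 a b ha hb].
- by rewrite !linear0 addr0.
- rewrite !(linearD (gtmap _ _ _)) hx hy scalerDr.
  exact: addrACA.
- rewrite !(gtmapE _ _ _ _ ha) ff tensDl tensZl scalerDr !scalerA.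
  by rewrite [k * _]mulrC.
Qed.

Lemma gtmap_linr d k (f : {linear A -> A'}) (g g1 g2 : {linear B -> B'}) y :
  (forall x, g x = k *: g1 x + g2 x) ->
  gtmap d f g y = k *: gtmap d f g1 y + gtmap d f g2 y.
Proof.
move=> gg; elim/gtens_ind: y => [|x y hx hy|d1 d2 a b ha hb].
- by rewrite !linear0 addr0.
- rewrite !(linearD (gtmap _ _ _)) hx hy scalerDr.
  exact: addrACA.
- rewrite !(gtmapE _ _ _ _ ha) gg tensDr tensZr scalerDr !scalerA.
  by rewrite [k * _]mulrC.
Qed.

End Gtmap.
End Graded.

(** * The inductive step of the dual Leibniz identity *)

(* These maps are used through their values on pure tensors only; unfolding them
exposes the quotient that defines the tensor product. *)
#[local] Arguments gtmap : simpl never.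
#[local] Arguments twist : simpl never.
#[local] Arguments gassoc : simpl never.
#[local] Arguments tassoc : simpl never.

(** [L] is any map of degree [e] that behaves towards [Delta] like left
multiplication by a letter [u]. *)
Section LeibnizStep.
Variables (K : fieldType) (n : nat) (C : gspace K n).
Variable Delta : {linear C -> gtensor C C}.
Hypothesis Delta0 : hom_map 0 Delta.
Variables (e : Zn n) (u : C) (L : {linear C -> C}).
Hypotheses (hu : gpart e u) (Delta_u : Delta u = 0) (hL : hom_map e L).
Hypothesis DeltaL : forall x,
  Delta (L x) = tens u x + gtmap 0 L idfun (Delta x) + gtmap e idfun L (Delta x).

Local Notation C2 := (gtensor C C).

(* [L1], [L2], [L3] apply [L] to one factor of [C (x) (C (x) C)]; [R1], [R2],
[R3] do the same on [(C (x) C) (x) C]. *)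
Let tu (B : gspace K n) : {linear B -> gtensor C B} :=
  lin_of ((tens_bilin C B).2 u).
Let L1 : {linear gtensor C C2 -> gtensor C C2} := gtmap 0 L idfun.
Let L2 : {linear gtensor C C2 -> gtensor C C2} :=
  gtmap e idfun (gtmap 0 L idfun).
Let L3 : {linear gtensor C C2 -> gtensor C C2} :=
  gtmap e idfun (gtmap e idfun L).
Let R1 : {linear gtensor C2 C -> gtensor C2 C} := gtmap 0 (gtmap 0 L idfun) idfun.
Let R2 : {linear gtensor C2 C -> gtensor C2 C} := gtmap 0 (gtmap e idfun L) idfun.
Let R3 : {linear gtensor C2 C -> gtensor C2 C} := gtmap e idfun L.
Let assoc := gassoc C C C.
Let tw : {linear gtensor C2 C -> gtensor C2 C} := gtmap 0 (twist C C) idfun.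

Let idDelta_L1 y : gtmap 0 idfun Delta (gtmap 0 L idfun y) = L1 (gtmap 0 idfun Delta y).
Proof.
elim/gtens_ind: y => [|x y hx hy|d1 d2 a b ha hb].
- by rewrite !linear0.
- by rewrite !linearD hx hy.
- by rewrite /L1 !gtmap0E.
Qed.

Let idDelta_L2 y : gtmap 0 idfun Delta (gtmap e idfun L y) =
  gtmap e idfun (tu C) y + L2 (gtmap 0 idfun Delta y) + L3 (gtmap 0 idfun Delta y).
Proof.
elim/gtens_ind: y => [|x y hx hy|d1 d2 a b ha hb].
- by rewrite !linear0 ?addr0.
- rewrite !linearD hx hy [LHS]addrACA; congr (_ + _).
  exact: addrACA.
- rewrite /L2 /L3 (gtmapE e _ _ b ha) linearZZ !gtmap0E !(gtmapE _ _ _ _ ha).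
  by rewrite /= DeltaL !tensDr !scalerDr.
Qed.

Let Deltaid_L1 y : gtmap 0 Delta idfun (gtmap 0 L idfun y) =
  gtmap 0 (tu C) idfun y + R1 (gtmap 0 Delta idfun y) + R2 (gtmap 0 Delta idfun y).
Proof.
elim/gtens_ind: y => [|x y hx hy|d1 d2 a b ha hb].
- by rewrite !linear0 ?addr0.
- rewrite !linearD hx hy [LHS]addrACA; congr (_ + _).
  exact: addrACA.
- by rewrite /R1 /R2 !gtmap0E /= DeltaL !tensDl.
Qed.

(* Moving [L] past [a] or past [Delta a] costs the same sign: this is where the
coproduct has to preserve degrees. *)
Let Deltaid_L2 y : gtmap 0 Delta idfun (gtmap e idfun L y) = R3 (gtmap 0 Delta idfun y).
Proof.
elim/gtens_ind: y => [|x y hx hy|d1 d2 a b ha hb].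
- by rewrite !linear0.
- by rewrite !linearD hx hy.
- rewrite /R3 (gtmapE e _ _ b ha) linearZZ !gtmap0E.
  by rewrite (gtmapE _ _ _ _ (hom_map0 Delta0 ha)).
Qed.

Let assocR1 z : assoc (R1 z) = L1 (assoc z).
Proof.
elim/gtens3_ind: z => [|x y hx hy|d1 d2 d3 a b c ha hb hc].
- by rewrite !linear0.
- by rewrite !linearD hx hy.
- by rewrite /R1 /L1 /assoc !gtmap0E /gassoc !tassocE gtmap0E.
Qed.

Let assocR2 z : assoc (R2 z) = L2 (assoc z).
Proof.
elim/gtens3_ind: z => [|x y hx hy|d1 d2 d3 a b c ha hb hc].
- by rewrite !linear0.
- by rewrite !linearD hx hy.
- rewrite /R2 /L2 /assoc !gtmap0E /gassoc !tassocE !(gtmapE _ _ _ _ ha) !gtmap0E.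
  by rewrite tensZl linearZZ tassocE.
Qed.

Let assocR3 z : assoc (R3 z) = L3 (assoc z).
Proof.
elim/gtens3_ind: z => [|x y hx hy|d1 d2 d3 a b c ha hb hc].
- by rewrite !linear0.
- by rewrite !linearD hx hy.
- rewrite /R3 /L3 /assoc /gassoc !tassocE (gtmapE _ _ _ _ (gpart_tens ha hb)).
  rewrite (gtmapE _ _ _ _ ha) (gtmapE _ _ _ _ hb).
  by rewrite linearZZ tassocE tensZr scalerA ksignDr.
Qed.

Let twR1 z : tw (R1 z) = R2 (tw z).
Proof.
elim/gtens3_ind: z => [|x y hx hy|d1 d2 d3 a b c ha hb hc].
- by rewrite !linear0.
- by rewrite !linearD hx hy.
- rewrite /R1 /R2 /tw !gtmap0E (twistE ha hb) (twistE (hL ha) hb).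
  by rewrite linearZZ (gtmapE _ _ _ _ hb) !tensZl scalerA ksignDl mulrC.
Qed.

(* The sign of moving [L] past the first factor disappears when that factor is
twisted to the other side, since the sign of the twist changes by the same
amount. *)
Let twR2 z : tw (R2 z) = R1 (tw z).
Proof.
elim/gtens3_ind: z => [|x y hx hy|d1 d2 d3 a b c ha hb hc].
- by rewrite !linear0.
- by rewrite !linearD hx hy.
- rewrite /R1 /R2 /tw !gtmap0E (gtmapE _ _ _ _ ha) linearZZ (twistE ha hb).
  rewrite (twistE ha (hL hb)) scalerA linearZZ gtmap0E !tensZl ksignDr.
  by rewrite mulrCA (ksignC _ e) ksign_sqr mulr1.
Qed.

Let twR3 z : tw (R3 z) = R3 (tw z).
Proof.
elim/gtens3_ind: z => [|x y hx hy|d1 d2 d3 a b c ha hb hc].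
- by rewrite !linear0.
- by rewrite !linearD hx hy.
- rewrite /R3 /tw (gtmapE _ _ _ _ (gpart_tens ha hb)) linearZZ !gtmap0E.
  rewrite -[X in twist C C X]/(tens a b) (twistE ha hb) !tensZl.
  rewrite [in RHS]linearZZ (gtmapE _ _ _ _ (gpart_tens hb ha)) !scalerA.
  by rewrite mulrC addrC.
Qed.

Let assoc_tu y : assoc (gtmap 0 (tu C) idfun y) = tu C2 y.
Proof.
elim/gtens_ind: y => [|x y hx hy|d1 d2 a b ha hb].
- by rewrite !linear0.
- by rewrite !linearD hx hy.
- by rewrite /assoc gtmap0E /gassoc tassocE.
Qed.

Let assoc_tw_tu y : assoc (tw (gtmap 0 (tu C) idfun y)) = gtmap e idfun (tu C) y.
Proof.
elim/gtens_ind: y => [|x y hx hy|d1 d2 a b ha hb].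
- by rewrite !linear0.
- by rewrite !linearD hx hy.
- rewrite /assoc /tw !gtmap0E (twistE hu ha) tensZl linearZZ /gassoc tassocE.
  by rewrite (gtmapE _ _ _ _ ha).
Qed.

Definition leibniz_at x :=
  gtmap 0 idfun Delta (Delta x) =
    gassoc C C C (gtmap 0 Delta idfun (Delta x)) +
    gassoc C C C (gtmap 0 (twist C C) idfun (gtmap 0 Delta idfun (Delta x))).

(** Both sides of the identity at [L x] are the images under [L1 + L2 + L3] of
those at [x], up to the two terms that contain [u], which agree. *)
Lemma leibniz_step x : leibniz_at x -> leibniz_at (L x).
Proof.
rewrite /leibniz_at -/assoc -/tw DeltaL.
set D := Delta x.
set X := gtmap 0 idfun Delta D; set Y := gtmap 0 Delta idfun D => hX.
have -> : gtmap 0 idfun Delta (tens u x + gtmap 0 L idfun D + gtmap e idfun L D)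
    = tu C2 D + L1 X + (gtmap e idfun (tu C) D + L2 X + L3 X).
  by rewrite 2!linearD idDelta_L1 idDelta_L2 gtmap0E.
have -> : gtmap 0 Delta idfun (tens u x + gtmap 0 L idfun D + gtmap e idfun L D)
    = gtmap 0 (tu C) idfun D + R1 Y + R2 Y + R3 Y.
  by rewrite 2!linearD Deltaid_L1 Deltaid_L2 gtmap0E Delta_u tens0l add0r.
rewrite !(linearD tw) !(linearD assoc) twR1 twR2 twR3 !assocR1 !assocR2 !assocR3.
rewrite assoc_tu assoc_tw_tu hX !(linearD L1) !(linearD L2) !(linearD L3).
(* Only the order of the summands differs. *)
by rewrite [LHS](AC (1*2*(1*2*2))%AC ((1*2*5*7)*(4*6*3*8))%AC).
Qed.

End LeibnizStep.

(** * The coproduct, built by adding a first letter *)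

Section Coproduct.
Variables (K : fieldType) (n : nat) (V : gspace K n).
Local Notation T := (redT V).
Local Notation TT := (gtensor T T).

Definition tinj (p : nat) : {linear tpow V p -> T} :=
  dinj (U := fun p => gcarrier (tpow V p)) p.

(** Left multiplication by a letter.  It raises the tensor power by one, so it
never produces a single letter: [lmul v 0] is 0, whereas the word with the only
letter [v] is [tinj 0 v]. *)
Definition lmul (v : V) : {linear T -> T} :=
  dlift (fun p =>
    lin_of (linE (tinj p.+1 \o lin_of ((tens_bilin V (tpow V p)).2 v)))).

Lemma lmul_inj v p (x : tpow V p) : lmul v (tinj p x) = tinj p.+1 (tens v x).
Proof. by rewrite [LHS]dlift_inj. Qed.

Lemma tinj_ind (P : T -> Prop) :
    P 0 -> (forall x y, P x -> P y -> P (x + y)) ->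
    (forall p x, P (tinj p x)) ->
  forall x, P x.
Proof.
move=> P0 PD Pi x; rewrite (dsum_dec (dsupp_uniq x) (@dsuppP _ _ _ x)).
by apply: (big_ind P P0 PD) => p _; exact: Pi.
Qed.

Lemma lmul_lin (x : T) : linear (fun v => lmul v x).
Proof.
move=> k v w; elim/tinj_ind: x => [|x y hx hy|p x].
- by rewrite !linear0 addr0.
- by rewrite !(linearD (lmul _)) hx hy scalerDr addrACA.
- by rewrite !lmul_inj tens_linl linearP.
Qed.

Lemma tinj_hom p : hom_map 0 (tinj p).
Proof.
move=> d x hx q; rewrite addr0.
case: (eqVneq p q) => [<-|pq]; first by rewrite dinj_in.
by rewrite dinj_out//; exact: gpart0.
Qed.

Lemma redT_ind (P : T -> Prop) :
    P 0 -> (forall x y, P x -> P y -> P (x + y)) ->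
    (forall d v, gpart d v -> P (tinj 0 v)) ->
    (forall d v x, gpart d v -> P x -> P (lmul v x)) ->
  forall x, P x.
Proof.
move=> P0 PD Pv PL; apply: tinj_ind => //; elim => [|p IH] y.
  rewrite (gcomp_sum y) linear_sum; apply: (big_ind P P0 PD) => d _.
  exact: Pv (gcomp_part _ _).
elim/gtens_ind: y => [|y z Py Pz|d e a b ha hb]; first by rewrite linear0.
  by rewrite linearD; exact: PD.
by rewrite -lmul_inj; exact: PL ha (IH b).
Qed.

(** The value of the coproduct at [v (x) x], given that at [x].  The degree of
[lmul v] enters the last term, so [v] is split into homogeneous components
there. *)
Definition coprod_step p (D : {linear tpow V p -> TT}) (v : V) (x : tpow V p) : TT :=
  tens (tinj 0 v) (tinj p x) + gtmap 0 (lmul v) idfun (D x) +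
  \sum_(d <- gsupp v) gtmap d idfun (lmul (gcomp d v)) (D x).

Fact coprod_step_bilin p (D : {linear tpow V p -> TT}) : bilin (coprod_step D).
Proof.
have F_lin x d : linear (fun v => gtmap d idfun (lmul v) (D x)).
  by move=> k v w; apply: gtmap_linr => y; exact: lmul_lin.
split=> [x k v w|v k x y]; rewrite /coprod_step.
  rewrite (gtmap_linl 0 (k := k) (f1 := lmul v) (f2 := lmul w)); last first.
    by move=> y; exact: lmul_lin.
  rewrite (gsum_lin (F_lin x)) linearP tens_linl !scalerDr.
  by rewrite [RHS]addrACA; congr (_ + _); exact: addrACA.
have S_lin : linear (fun x =>
    \sum_(d <- gsupp v) gtmap d idfun (lmul (gcomp d v)) (D x)).
  by apply: linear_sumP => d; exact: linE (gtmap d idfun _ \o D).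
rewrite S_lin !linearP (tens_bilin _ _).2 !scalerDr.
by rewrite [RHS]addrACA; congr (_ + _); exact: addrACA.
Qed.

Fixpoint coprod_at p : {linear tpow V p -> TT} :=
  match p with
  | 0 => \0
  | p'.+1 => tlift (coprod_step_bilin (coprod_at p'))
  end.

Definition coprod : {linear T -> TT} := dlift coprod_at.

Lemma coprod_letter v : coprod (tinj 0 v) = 0.
Proof. by rewrite [LHS]dlift_inj. Qed.

(** The recursion that is used from now on in place of the definition. *)
Lemma coprod_lmul d v x : gpart d v ->
  coprod (lmul v x) = tens (tinj 0 v) x + gtmap 0 (lmul v) idfun (coprod x)
                      + gtmap d idfun (lmul v) (coprod x).
Proof.
move=> hv; elim/tinj_ind: x => [|x y hx hy|p x].
- by rewrite !linear0 tens0r !addr0.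
- rewrite !(linearD (lmul v)) !(linearD coprod) hx hy !(linearD (gtmap _ _ _)).
  by rewrite tensDr [LHS]addrACA; congr (_ + _); exact: addrACA.
rewrite lmul_inj ![coprod _]dlift_inj [LHS]tlift_tens.
congr (_ + _).
apply: (gsum_hom (F := fun d v => gtmap d idfun (lmul v) (coprod_at p x)) _ hv).
by move=> e k v' w; apply: gtmap_linr => y; exact: lmul_lin.
Qed.

Lemma lmul_hom d v : gpart d v -> hom_map d (lmul v).
Proof.
move=> hv e x hx; rewrite (dsum_dec (dsupp_uniq x) (@dsuppP _ _ _ x)).
rewrite linear_sum; apply: gpart_sum => p.
rewrite -/(tinj p) lmul_inj; apply: (hom_map0 (@tinj_hom p.+1)).
by rewrite addrC; apply: gpart_tens => //; exact: hx.
Qed.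

Lemma coprod_hom : hom_map 0 coprod.
Proof.
move=> d x hx; rewrite addr0 (dsum_dec (dsupp_uniq x) (@dsuppP _ _ _ x)).
rewrite linear_sum; apply: gpart_sum => p.
move: (x p) (hx p); rewrite -/(tinj p) => y.
move: hx => _; elim: p d y => [|p IH] d y.
  by rewrite coprod_letter => _; exact: gpart0.
elim=> [|c _ z [d1 d2 a b <- ha hb] _ hz]; first by rewrite !linear0; exact: gpart0.
rewrite !linearP; apply: gpart_lin => //.
rewrite -lmul_inj (coprod_lmul _ ha); apply: gpartD; first apply: gpartD.
- by apply: gpart_tens; apply: (hom_map0 (@tinj_hom _)).
- rewrite addrC -{1}[d1]addr0; apply: gtmap_hom (IH _ _ hb); first exact: lmul_hom.
  by move=> e t; rewrite addr0.
- rewrite addrC -{1}[d1]add0r; apply: gtmap_hom (IH _ _ hb); last exact: lmul_hom.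
  by move=> e t; rewrite addr0.
Qed.

Lemma coprod_leibniz : dual_leibniz_identity coprod.
Proof.
elim/redT_ind => [|x y hx hy|d v hv|d v x hv hx].
- by rewrite !linear0 addr0.
- by rewrite !linearD hx hy addrACA.
- by rewrite coprod_letter !linear0 addr0.
- apply: (leibniz_step (u := tinj 0 v) coprod_hom _ _ (lmul_hom hv)) => //.
  + exact: (hom_map0 (@tinj_hom 0)).
  + exact: coprod_letter.
  + by move=> y; exact: coprod_lmul.
Qed.

End Coproduct.

(** * Unshuffles and the first letter *)

Section SplitFirst.
Variable p : nat.

(** Subsets of [p + 1] positions correspond to pairs of a boolean, which tells
whether the first position belongs to the subset, and a subset of the [p]
others. *)
Definition cons_set (b : bool) (I : {set 'I_p}) : {set 'I_p.+1} :=
  [set i | if unlift ord0 i is Some j then j \in I else b].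

Lemma mem_cons_set0 b I : (ord0 \in cons_set b I) = b.
Proof. by rewrite inE unlift_none. Qed.

Lemma mem_cons_setS b I j : (lift ord0 j \in cons_set b I) = (j \in I).
Proof. by rewrite inE liftK. Qed.

Lemma cons_setC b I : ~: cons_set b I = cons_set (~~ b) (~: I).
Proof. by apply/setP => i; rewrite !inE; case: unliftP => [j _|_]; rewrite ?inE. Qed.

Lemma cons_set_eq0 b I : (cons_set b I == set0) = ~~ b && (I == set0).
Proof.
apply/eqP/andP => [E|[/negbTE -> /eqP ->]].
  split; first by rewrite -(mem_cons_set0 b I) E inE.
  by apply/eqP/setP => j; rewrite -(mem_cons_setS b) E !inE.
by apply/setP => i; rewrite !inE; case: unliftP => // j; rewrite inE.
Qed.

Lemma enum_cons_set b I :
  enum (cons_set b I) = nseq b ord0 ++ [seq lift ord0 j | j <- enum I].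
Proof.
rewrite [LHS]/enum_mem -enumT enum_ordSl /= mem_cons_set0 filter_map.
rewrite [enum I]/enum_mem -enumT.
have -> : filter (preim (lift ord0) (mem (cons_set b I))) (enum 'I_p) =
          filter (mem I) (enum 'I_p).
  by apply: eq_filter => j; exact: mem_cons_setS.
by case: b.
Qed.

Lemma big_cons_set (M : zmodType) (F : {set 'I_p.+1} -> M) :
  \sum_(I | I != set0) F I = \sum_I F (cons_set true I)
                             + \sum_(I | I != set0) F (cons_set false I).
Proof.
rewrite (reindex (fun x : bool * {set 'I_p} => cons_set x.1 x.2)) /=.
  rewrite -(pair_big_dep xpredT (fun b I => cons_set b I != set0)
    (fun b I => F (cons_set b I))) big_bool /=.
  by congr (_ + _); apply: eq_bigl => I; rewrite cons_set_eq0.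
exists (fun I : {set 'I_p.+1} => (ord0 \in I, [set j | lift ord0 j \in I]))
  => [[b I] _|I _] /=.
  by rewrite mem_cons_set0; congr (_, _); apply/setP => j; rewrite inE mem_cons_setS.
by apply/setP => i; rewrite inE; case: unliftP => [j ->|->]; rewrite ?inE.
Qed.

End SplitFirst.

Section KoszulFirst.
Variables (K : fieldType) (n p : nat) (deg : 'I_p.+1 -> Zn n).
Local Notation deg' := (fun i => deg (lift ord0 i)).

Lemma unshuffle_sign0 q (d : 'I_q -> Zn n) : unshuffle_sign K d set0 (~: set0) = 1.
Proof.
rewrite /unshuffle_sign enum_set0 setC0 enum_setT koszul_sorted //.
by have := iota_ltn_sorted 0 q; rewrite -val_enum_ord sorted_map enumT.
Qed.

Lemma koszul_lift (s : seq 'I_p) :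
  koszul K deg [seq lift ord0 i | i <- s] = koszul K deg' s.
Proof. by elim: s => //= i s <-; rewrite big_map. Qed.

(** A first letter that goes to the left word stays in front of all letters. *)
Lemma unshuffle_sign_inl (I J : {set 'I_p}) :
  unshuffle_sign K deg (cons_set true I) (cons_set false J) =
  unshuffle_sign K deg' I J.
Proof.
rewrite /unshuffle_sign !enum_cons_set /= -map_cat koszul_lift.
by rewrite big_pred0 ?mul1r.
Qed.

(** A first letter that goes to the right word moves past the whole left word,
so the sign depends only on the total degree of the latter. *)
Lemma unshuffle_sign_inr (I J : {set 'I_p}) :
  unshuffle_sign K deg (cons_set false I) (cons_set true J) =
  ksign K (deg ord0) (\sum_(i <- enum I) deg' i) * unshuffle_sign K deg' I J.
Proof.
rewrite /unshuffle_sign !enum_cons_set /= ksign_sumr.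
elim: (enum I) => [|i s IH] /=.
  by rewrite big_nil big_pred0 ?mul1r ?koszul_lift.
rewrite IH big_cons !big_cat !big_cons !big_map (ksignC _ (deg ord0)) /=.
rewrite -!mulrA mulrCA; congr (_ * _).
by rewrite [RHS]mulrCA; congr (_ * _); rewrite [RHS]mulrCA.
Qed.

End KoszulFirst.

(** * Words, uniqueness and the unshuffle formula *)

Section Words.
Variables (K : fieldType) (n : nat) (V : gspace K n).
Local Notation T := (redT V).

Lemma lmul_tword (v : V) s : s != [::] -> lmul v (tword s) = tword (v :: s).
Proof. by case: s => // w s _; exact: lmul_inj. Qed.

Lemma tword_hom (I : eqType) (deg : I -> Zn n) (v : I -> V) (s : seq I) :
  (forall i, gpart (deg i) (v i)) ->
  gpart (\sum_(i <- s) deg i) (tword [seq v i | i <- s]).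
Proof.
move=> hv; elim: s => [|i [|j s] IH]; first exact: gpart0.
  by rewrite big_seq1; exact: (hom_map0 (@tinj_hom _ _ _ 0)).
rewrite big_cons addrC map_cons -lmul_tword //.
exact: (lmul_hom (hv i)).
Qed.

(** Two linear maps that agree on words with homogeneous letters are equal.  The
induction on the tensor power applies to the maps composed with [lmul a], where
[a] is the first letter. *)
Lemma redT_ext (W : lmodType K) (f g : {linear T -> W}) :
  (forall p (deg : 'I_p.+1 -> Zn n) (v : 'I_p.+1 -> V),
    (forall i, gpart (deg i) (v i)) ->
    f (tword [seq v i | i <- enum 'I_p.+1]) =
    g (tword [seq v i | i <- enum 'I_p.+1])) -> f =1 g.
Proof.
move=> fg; elim/tinj_ind => [|x y hx hy|p x]; first by rewrite !linear0.
  by rewrite !linearD hx hy.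
elim: p => [|p IH] in f g fg x *.
  rewrite (gcomp_sum x) !linear_sum; apply: eq_bigr => d _.
  have := fg 0 (fun=> d) (fun=> gcomp d x) (fun=> gcomp_part _ _).
  by rewrite enum_ordSl /= (size0nil (size_enum_ord 0)).
elim/gtens_ind: x => [|x y hx hy|d e a b ha hb]; first by rewrite !linear0.
  by rewrite !linearD hx hy.
rewrite -lmul_inj; apply: (IH (f \o lmul a) (g \o lmul a)) => q deg v hv.
rewrite -[LHS]/(f (lmul a _)) -[RHS]/(g (lmul a _)).
pose ext (U : Type) (u : U) (w : 'I_q.+1 -> U) i := oapp w u (unlift ord0 i).
have -> : lmul a (tword [seq v i | i <- enum 'I_q.+1]) =
          tword [seq ext _ a v i | i <- enum 'I_q.+2].
  rewrite lmul_tword; last by rewrite enum_ordSl.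
  rewrite (enum_ordSl q.+1) map_cons -map_comp /ext unlift_none.
  congr (tword (_ :: _)).
  by apply: eq_map => j /=; rewrite liftK.
apply: (fg q.+1 (ext _ d deg)) => i; rewrite /ext.
by case: unliftP => [j _|_]; [exact: hv|exact: ha].
Qed.

(** The subsets that contain the first position give the terms [v (x) x] (the
subset of the other positions is empty) and [(L_v (x) id) (Delta x)]; those that
do not give [(id (x) L_v) (Delta x)]. *)
Lemma coprod_formula : coproduct_formula (coprod V).
Proof.
elim=> [|p IH] deg v hv w.
  rewrite enum_ordSl (size0nil (size_enum_ord 0)) [LHS]coprod_letter big_pred0//.
  by move=> I; apply/negbTE; rewrite negbK; apply/eqP/setP => -[].
pose l := @lift p.+2 ord0.
have hv' i : gpart (deg (l i)) (v (l i)) by [].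
rewrite [enum _]enum_ordSl map_cons -map_comp -lmul_tword; last by rewrite enum_ordSl.
rewrite (coprod_lmul _ (hv ord0)) (IH _ _ hv').
set w' := widen_ord (leqnSn p).
have wl i : w (lift ord0 i) = l (w' i) by apply: val_inj.
have w0 : w ord0 = ord0 by apply: val_inj.
have lm : l ord_max = ord_max by apply: val_inj.
rewrite big_cons_set [\sum_I _](bigD1 set0) // -!addrA.
set d' := fun i => deg (l (w' i)).
have dE : (fun i => deg (w (lift ord0 i))) = d'.
  by apply: boolp.funext => i; rewrite wl.
have signt I : unshuffle_sign K (fun i => deg (w i)) (cons_set true I)
    (~: cons_set true I) = unshuffle_sign K d' I (~: I).
  by rewrite cons_setC unshuffle_sign_inl dE.
have signf I : unshuffle_sign K (fun i => deg (w i)) (cons_set false I)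
    (~: cons_set false I) =
    ksign K (deg ord0) (\sum_(i <- enum I) d' i) * unshuffle_sign K d' I (~: I).
  rewrite cons_setC unshuffle_sign_inr w0 dE; congr (ksign _ _ _ * _).
  by apply: eq_bigr => i _; rewrite wl.
have words b I : [seq v (w i) | i <- enum (cons_set b I)] =
    nseq b (v ord0) ++ [seq v (l (w' i)) | i <- enum I].
  rewrite enum_cons_set map_cat -map_comp; congr (_ ++ _).
    by case: b; rewrite /= ?w0.
  by apply: eq_map => i /=; rewrite wl.
congr (_ + _); last congr (_ + _).
- rewrite signt unshuffle_sign0 scale1r cons_setC !words setC0 enum_set0.
  congr (tens _ (tword _)); rewrite enum_ordSr map_rcons /= -/l lm enum_setT enumT.
  by rewrite -map_comp.
- rewrite linear_sum; apply: eq_bigr => I I0.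
  rewrite linearZZ gtmap0E signt cons_setC !words lmul_tword ?lm//.
  by rewrite -size_eq0 size_map -cardE cards_eq0.
- rewrite linear_sum; apply: eq_bigr => I I0.
  rewrite linearZZ (gtmapE _ _ _ _ (tword_hom _ (fun i => hv' (w' i)))).
  rewrite signf cons_setC !words scalerA mulrC lmul_tword ?lm//.
  by rewrite -size_eq0 size_rcons.
Qed.

End Words.

Theorem proposition4 (K : fieldType) (char0 : [pchar K] =i pred0)
    (n : nat) (V : gspace K n) :
  exists Delta : {linear redT V -> gtensor (redT V) (redT V)},
    [/\ coproduct_formula Delta,
        forall Delta' : {linear redT V -> gtensor (redT V) (redT V)},
          coproduct_formula Delta' -> Delta' =1 Delta
      & graded_dual_leibniz_coalgebra Delta].
Proof.
exists (coprod V); split; first exact: coprod_formula.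
  move=> D hD; apply: redT_ext => p deg v hv.
  by rewrite (hD p deg v hv) (coprod_formula hv).
split; last exact: coprod_leibniz.
by move=> d x; exact: (hom_map0 (@coprod_hom _ _ V)).
Qed.
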